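(* Let $G$ be a convex bipartite graph (given with its convex ordering $X=(x_1,\ldots,x_n)$) satisfying Property A. Then a Hamiltonian cycle of $G$ can be found in time linear in the size of the input.
   Context: All graphs are finite, simple, connected and unweighted. A convex bipartite graph is a bipartite graph $G$ with bipartition $(X,Y)$ together with an ordering $X=(x_1,\ldots,x_n)$ such that for every $y\in Y$ the neighborhood $N_G(y)$ consists of consecutive vertices of this ordering; $n=|X|$. For $1\le p<q\le n$ let $X_{p..q}=\{x_p,\ldots,x_q\}$, $N_G[X_{p..q}]=\{y\in Y : N_G(y)\subseteq X_{p..q}\}$ and $N'_G[X_{p..q}]=\{y\in Y : |N_G(y)\cap X_{p..q}|\ge 2\}$. $G$ satisfies Property A if: (1) for all $1\le p<q\le n$ with $(p,q)\neq(1,n)$, $|N_G[X_{p..q}]|\le q-p$; (2) for every integer $j\in\{1,\ldots,n-1\}$ and all indices with $1\le p_1<q_1\le p_2<q_2\le\cdots\le p_j<q_j\le n$, $\left|\bigcup_{i=1}^j N'_G[X_{p_i..q_i}]\right|\ge\sum_{i=1}^j (q_i-p_i)$; (3) $|N_G[X_{1..n}]|=|N'_G[X_{1..n}]|=n$. *)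

(* Defs.v *)
From mathcomp Require Import all_boot.

Set Implicit Arguments.
Unset Strict Implicit.
Unset Printing Implicit Defensive.

(* A simple bipartite graph with bipartition (X, Y); X comes with the ordering
   of its indices: its i-th vertex x_i is the element of 'I_nX of value i - 1. *)
Record bigraph := Bigraph {
  nX : nat;
  nY : nat;
  adj : 'I_nX -> 'I_nY -> bool
}.

Section Graph.

Variable G : bigraph.

Definition vertex : Type := ('I_(nX G) + 'I_(nY G))%type.

Definition edge : rel vertex := fun u v =>
  match u, v with
  | inl x, inr y => adj x y
  | inr y, inl x => adj x y
  | _, _ => false
  end.

(* The graph without vertices is not connected. *)
Definition connected : Prop :=
  0 < #|{: vertex}| /\ forall u v : vertex, connect edge u v.

Definition nbr (y : 'I_(nY G)) : {set 'I_(nX G)} := [set x | adj x y].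

Definition convex : Prop :=
  forall (y : 'I_(nY G)) (x1 x2 x3 : 'I_(nX G)),
    x1 <= x2 <= x3 -> x1 \in nbr y -> x3 \in nbr y -> x2 \in nbr y.

(* The bounds p and q are 1-based. *)
Definition Xint (p q : nat) : {set 'I_(nX G)} := [set x : 'I_(nX G) | p <= x.+1 <= q].

Definition NX (p q : nat) : {set 'I_(nY G)} :=
  [set y | nbr y \subset Xint p q].

Definition NX' (p q : nat) : {set 'I_(nY G)} :=
  [set y | 2 <= #|nbr y :&: Xint p q|].

Definition propertyA : Prop :=
  [/\ forall p q : nat, 1 <= p -> p < q -> q <= nX G ->
        (p, q) <> (1, nX G) -> #|NX p q| <= q - p,
      forall (j : nat) (p q : 'I_j -> nat), 1 <= j <= (nX G).-1 ->
        (forall i : 'I_j, [&& 1 <= p i, p i < q i & q i <= nX G]) ->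
        (forall i i' : 'I_j, i' = i.+1 :> nat -> q i <= p i') ->
        \sum_(i < j) (q i - p i) <= #|\bigcup_(i < j) NX' (p i) (q i)|
    & #|NX 1 (nX G)| = nX G /\ #|NX' 1 (nX G)| = nX G].

Definition hamiltonian_cycle (c : seq vertex) : Prop :=
  [/\ 2 < size c, ucycle edge c & forall v : vertex, v \in c].

Definition gsize : nat := nX G + nY G + #|[set e : 'I_(nX G) * 'I_(nY G) | adj e.1 e.2]|.

End Graph.

(* A unit-cost random access machine, presented as a structured language.
   Registers and memory cells hold natural numbers; Sub is truncated; a test
   succeeds when the value of its expression is nonzero. *)

Inductive expr :=
  | Const of nat
  | Reg of nat
  | Fetch of expr
  | Add of expr & expr
  | Sub of expr & expr.

Inductive com :=
  | Skip
  | Assign of nat & expr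
  | Store of expr & expr
  | Seq of com & com
  | If of expr & com & com
  | While of expr & com.

Record state := State { reg : nat -> nat; cell : nat -> nat }.

Definition upd (f : nat -> nat) (a v : nat) : nat -> nat :=
  fun b => if b == a then v else f b.

Fixpoint eval (s : state) (e : expr) : nat :=
  match e with
  | Const k => k
  | Reg r => reg s r
  | Fetch e1 => cell s (eval s e1)
  | Add e1 e2 => eval s e1 + eval s e2
  | Sub e1 e2 => eval s e1 - eval s e2
  end.

Fixpoint cost (e : expr) : nat :=
  match e with
  | Const _ | Reg _ => 1
  | Fetch e1 => (cost e1).+1
  | Add e1 e2 | Sub e1 e2 => (cost e1 + cost e2).+1
  end.

(* No overflow: all values met while evaluating e fit in a machine word. *)
Fixpoint fits (W : nat) (s : state) (e : expr) : bool :=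
  (eval s e <= W) &&
  match e with
  | Const _ | Reg _ => true
  | Fetch e1 => fits W s e1
  | Add e1 e2 | Sub e1 e2 => fits W s e1 && fits W s e2
  end.

(* exec W c s t s': started in s, the program c halts in s' after t steps, all
   words computed on the way being at most W.  There is no rule for a step that
   overflows, so such a run does not halt.  Taking W linear in the size of the
   input gives words of logarithmically many bits. *)
Inductive exec (W : nat) : com -> state -> nat -> state -> Prop :=
  | ExecSkip s : exec W Skip s 1 s
  | ExecAssign r e s : fits W s e ->
      exec W (Assign r e) s (cost e).+1
        (State (upd (reg s) r (eval s e)) (cell s))
  | ExecStore e1 e2 s : fits W s e1 -> fits W s e2 ->
      exec W (Store e1 e2) s (cost e1 + cost e2).+1
        (State (reg s) (upd (cell s) (eval s e1) (eval s e2)))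
  | ExecSeq c1 c2 s s1 s2 t1 t2 :
      exec W c1 s t1 s1 -> exec W c2 s1 t2 s2 ->
      exec W (Seq c1 c2) s (t1 + t2) s2
  | ExecIf e c1 c2 s s' t : fits W s e ->
      exec W (if eval s e != 0 then c1 else c2) s t s' ->
      exec W (If e c1 c2) s ((cost e).+1 + t) s'
  | ExecWhileStop e c s : fits W s e -> eval s e = 0 ->
      exec W (While e c) s (cost e).+1 s
  | ExecWhileStep e c s s1 s2 t1 t2 : fits W s e -> eval s e != 0 ->
      exec W c s t1 s1 -> exec W (While e c) s1 t2 s2 ->
      exec W (While e c) s ((cost e).+1 + t1 + t2) s2.

(* L lists the neighbours of each y in Y, in an arbitrary order. *)
Definition adjacency_lists (G : bigraph) (L : 'I_(nY G) -> seq 'I_(nX G)) :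
  Prop := forall y, perm_eq (L y) (enum (nbr y)).

(* The input words: |X|, |Y|, then for each y its degree and its neighbours.
   The lists of the vertices of X would be redundant and are not supplied. *)
Definition encode (G : bigraph) (L : 'I_(nY G) -> seq 'I_(nX G)) : seq nat :=
  nX G :: nY G ::
  flatten [seq size (L y) :: [seq nat_of_ord x | x <- L y] | y <- enum 'I_(nY G)].

Definition init_state (w : seq nat) : state :=
  State (fun _ => 0) (fun a => nth 0 w a).

(* The output is the block of memory whose address is in register 0 and whose
   length is in register 1. *)
Definition output (s : state) : seq nat :=
  [seq cell s a | a <- iota (reg s 0) (reg s 1)].

Definition vcode (G : bigraph) (v : vertex G) : nat :=
  match v with inl x => nat_of_ord x | inr y => nX G + y end.

(* Main.v *)
(* Number the vertices of X by 0, ..., n - 1.  Property A forces |Y| = n and makes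
   every y an interval [lo y, e y) of at least two positions.  Regard y as a unit
   job released at time lo y which has to run in a slot h (the gap between x_h and
   x_(h+1)) with h + 1 < e y.  Schedule the jobs in the slots 0, ..., n - 1, earliest
   deadline first.  Part (1) of Property A is Hall's condition for all proper
   intervals; hence no job is late, except that slot n - 1, which is not a gap,
   holds one job ending at x_(n-1).

   Let s_h be the job in slot h.  The cycle consists of two paths from x_0 to
   x_(n-1), both increasing in X.  At each x_g one path waits at a spare job, and
   the other one, arriving at x_g through s_(g-1), goes on to s_g.  When s_g is
   itself the spare job, the path at x_g instead goes on to a job released by time
   g and placed in a later slot (one exists by Hall's condition for [g + 1, n)).
   That job becomes the spare one and the two paths exchange their roles.

   For linear time, the schedule is computed by inserting the jobs one by one at
   their release times.  On a collision the job with the later deadline moves on by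
   one slot.  A job y never moves more than |N(y)| times. *)

Require Import Defs.
From mathcomp Require Import all_boot.
From mathcomp Require Import zify.
From Stdlib Require Import FunctionalExtensionality.

Set Implicit Arguments.
Unset Strict Implicit.
Unset Printing Implicit Defensive.

Lemma upd_same f a v : upd f a v a = v.
Proof. by rewrite /upd eqxx. Qed.

Lemma upd_other f a v b : b <> a -> upd f a v b = f b.
Proof. by rewrite /upd => /eqP/negbTE->. Qed.

(** * Earliest-deadline-first schedules *)

Section Schedule.

Variables (n : nat) (lo e : nat -> nat).

(* The jobs below k other than c are placed, y in slot sg y; the job c is being
   inserted and is currently compared with the content of slot sg c.  If c >= k,
   as in edf k k sg, no job is being inserted. *)
Definition edf (k c : nat) (sg : nat -> nat) : Prop :=
  [/\ forall y, y < k -> lo y <= sg y,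
      forall y z, y < k -> z < k -> y != c -> z != c -> sg y = sg z -> y = z
    & forall y h, y < k -> lo y <= h < sg y ->
        exists z, [/\ z < k, z != c, sg z = h & e z <= e y]].

Lemma edf_insert k sg : edf k k sg -> edf k.+1 k (upd sg k (lo k)).
Proof.
have E y : y < k -> upd sg k (lo k) y = sg y by move=> yk; rewrite upd_other; lia.
move=> [Elo Einj Estab]; split.
- move=> y; rewrite ltnS leq_eqVlt => /orP[/eqP->|yk]; first by rewrite upd_same.
  by rewrite E // Elo.
- move=> y z yk zk yc zc; rewrite !E; try by lia.
  by apply: Einj; lia.
- move=> y h; rewrite ltnS leq_eqVlt => /orP[/eqP->|yk]; rewrite ?upd_same ?E //.
    by lia.
  by move=> hh; have [z [zk zc zh ez]] := Estab y h yk hh; exists z; rewrite E //; split; lia.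
Qed.

Lemma edf_place k c sg : edf k c sg ->
  (forall z, z < k -> z != c -> sg z <> sg c) -> edf k k sg.
Proof.
move=> [Elo Einj Estab] free; split=> // [y z yk zk _ _ yz|y h yk hh].
- have [yc|yc] := eqVneq y c; have [zc|zc] := eqVneq z c.
  + by rewrite yc zc.
  + by case: (free z zk zc); rewrite -yz yc.
  + by case: (free y yk yc); rewrite yz zc.
  + exact: Einj.
- have [z [zk zc zh ez]] := Estab y h yk hh; exists z; split=> //; lia.
Qed.

(** The occupant [z] is itself the witness that the slot passed over by [c] holds a job with no
    later deadline. *)
Lemma edf_skip k c z sg : edf k c sg -> z < k -> z != c -> sg z = sg c ->
  e z <= e c -> edf k c (upd sg c (sg c).+1).
Proof.
have E y : y != c -> upd sg c (sg c).+1 y = sg y by move/eqP; apply: upd_other.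
move=> [Elo Einj Estab] zk zc zh ez; split.
- move=> y yk; have [yc|yc] := eqVneq y c; last by rewrite E // Elo.
  by rewrite yc upd_same leqW // -yc Elo.
- by move=> y v yk vk yc vc; rewrite !E // => ?; apply: Einj.
- move=> y h yk; have [yc|yc] := eqVneq y c.
    rewrite yc in yk *; rewrite upd_same => hh; have [hc|hc] := eqVneq h (sg c).
      by exists z; rewrite E //; split=> //; rewrite hc.
    have [||v [vk vc vh ev]] := Estab c h; try by lia.
    by exists v; rewrite E.
  rewrite E // => hh; have [v [vk vc vh ev]] := Estab y h yk hh.
  by exists v; rewrite E.
Qed.

(** Once [c] takes over the slot of [z], it replaces [z] as a witness everywhere, because its
    deadline is earlier. *)
Lemma edf_swap k c z sg : edf k c sg -> c < k -> z < k -> z != c -> sg z = sg c ->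
  e c < e z -> edf k z (upd sg z (sg z).+1).
Proof.
have E y : y != z -> upd sg z (sg z).+1 y = sg y by move/eqP; apply: upd_other.
move=> [Elo Einj Estab] ck zk zc zh ez; split.
- move=> y yk; have [yz|yz] := eqVneq y z; last by rewrite E // Elo.
  by rewrite yz upd_same leqW // -yz Elo.
- move=> y v yk vk yz vz; rewrite !E // => yv.
  have [yc|yc] := eqVneq y c; have [vc|vc] := eqVneq v c.
  + by rewrite yc vc.
  + by case/eqP: vz; apply: Einj => //; rewrite zh -yv yc.
  + by case/eqP: yz; apply: Einj => //; rewrite zh yv vc.
  + exact: Einj.
have K y h : y < k -> lo y <= h < sg y ->
    exists v, [/\ v < k, v != z, sg v = h & e v <= e y].
  move=> yk hh; have [v [vk vc vh ev]] := Estab y h yk hh.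
  have [vz|vz] := eqVneq v z; last by exists v.
  by subst v; exists c; split=> //; lia.
move=> y h yk; have [yz|yz] := eqVneq y z.
  rewrite yz in yk *; rewrite upd_same => hh; have [hz|hz] := eqVneq h (sg z).
    by exists c; rewrite E; [split=> //; lia | lia].
  have [||v [vk vz vh ev]] := K z h; try by lia.
  by exists v; rewrite E.
rewrite E // => hh; have [v [vk vz vh ev]] := K y h yk hh.
by exists v; rewrite E.
Qed.

Hypothesis job_len : forall y, y < n -> lo y + 2 <= e y <= n.
(** Part (1) of Property A for the half-open, 0-based interval [p, q), which has [q - p - 1]
    gaps. *)
Hypothesis hall : forall p q, p.+1 < q -> q <= n -> (0 < p) || (q < n) ->
  count (fun y => (p <= lo y) && (e y <= q)) (iota 0 n) <= (q - p).-1.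

(* Let t be the start of the longest run of slots ending before sg y that hold jobs
   with deadlines at most e y.  All these jobs are released at t or later, so that
   together with y they are jobs contained in [t, e y), and Hall's condition bounds
   their number.  The induction on t searches for this start downwards from lo y. *)
Lemma edf_bound k c sg y : k <= n -> edf k c sg -> y < k ->
  sg y < e y /\ ((sg y).+1 < n -> (sg y).+1 < e y).
Proof.
move=> kn [Elo Einj Estab] yk.
have /andP[lenL lenR] : lo y + 2 <= e y <= n by apply/job_len; lia.
have slots_count t : t <= lo y ->
    (forall h, t <= h < sg y ->
       exists z, [/\ z < k, z != c, sg z = h, e z <= e y & t <= lo z]) ->
    sg y < e y /\ ((sg y).+1 < n -> (sg y).+1 < e y).
  move=> tlo full; have lo_sg := Elo y yk.
  pose T := [seq z <- iota 0 n | (t <= lo z) && (e z <= e y)].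
  have yT : y \in T by rewrite mem_filter tlo leqnn mem_iota; lia.
  have uT : uniq T by rewrite filter_uniq ?iota_uniq.
  (* The slots in [t, sg y) hold distinct jobs of [T] other than [y], which is itself at [sg y]. *)
  have : size (iota t (sg y - t)) <= size (map sg (rem y T)).
    apply: uniq_leq_size => [|h]; first exact: iota_uniq.
    rewrite mem_iota => hh.
    have [|z [zk _ zh ez tz]] := full h; first by lia.
    rewrite -zh; apply: map_f; rewrite mem_rem_uniq // inE mem_filter ez tz mem_iota.
    rewrite !andTb; apply/andP; split; last by lia.
    by apply/eqP => zy; rewrite -zh zy in hh; lia.
  rewrite size_iota size_map size_rem //.
  have Tgt0 : 0 < size T by case: T yT {uT}.
  (* Only the interval [0, n) escapes Hall's condition. There the total number n of jobs still keeps
     [y] within the n slots; this is why slot [n.-1] is exempt in the conclusion. *)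
  have [tq|tq] := boolP ((0 < t) || (e y < n)).
    have te : t.+1 < e y by lia.
    have := hall te lenR tq; rewrite -size_filter -/T.
    by case: (size T) Tgt0 => // m _ /=; lia.
  have : size T <= size (iota 0 n) by rewrite size_filter count_size.
  by rewrite size_iota; case: (size T) Tgt0 => // m _ /=; lia.
suff H t : t <= lo y ->
    (forall h, t <= h < sg y -> exists z, [/\ z < k, z != c, sg z = h & e z <= e y]) ->
    sg y < e y /\ ((sg y).+1 < n -> (sg y).+1 < e y).
  by apply: (H (lo y)) => // h hh; apply: Estab.
elim: t => [|t IHt] tlo full.
  apply: (slots_count 0) => // h hh; have [z [zk zc zh ez]] := full h hh.
  by exists z.
(* A bad job sits in the run but is released by time [t]. It has passed slot [t], so that slot is
   full too and the run extends downwards. *)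
pose bad (z : nat) := [&& z != c, t < sg z < sg y, e z <= e y & lo z <= t].
have [/hasP[z]|/hasPn ok] := boolP (has bad (iota 0 k)).
  rewrite mem_iota => zk /and4P[zc sz ez lz].
  apply: IHt => [|h hh]; first by lia.
  have [th|th] := ltnP t h; first by apply: full; lia.
  have [||v [vk vc vh ev]] := Estab z h; try by lia.
  by exists v; split=> //; lia.
apply: (slots_count t.+1) => // h hh; have [z [zk zc zh ez]] := full h hh.
exists z; split=> //; rewrite ltnNge; apply/negP => lz.
have /negP[] : ~~ bad z by apply: ok; rewrite mem_iota.
by apply/and4P; split=> //; lia.
Qed.

(** * The inverse of a complete schedule *)

Section Slots.

Variable sg : nat -> nat.
Hypothesis sgP : edf n n sg.

Let sg_lo y : y < n -> lo y <= sg y.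
Proof. by case: sgP => H _ _; apply: H. Qed.

Let sg_hi y : y < n -> sg y < e y /\ ((sg y).+1 < n -> (sg y).+1 < e y).
Proof. exact: edf_bound sgP. Qed.

Let sg_ltn y : y < n -> sg y < n.
Proof. by move=> yn; have := sg_hi yn; have := job_len yn; lia. Qed.

Let sg_inj y z : y < n -> z < n -> sg y = sg z -> y = z.
Proof. by case: sgP => _ H _ yn zn; apply: H => //; lia. Qed.

Definition job h := index h (map sg (iota 0 n)).

Lemma job_sg y : y < n -> job (sg y) = y.
Proof.
move=> yn; have -> : sg y = nth 0 (map sg (iota 0 n)) y.
  by rewrite (nth_map 0) ?size_iota // nth_iota.
rewrite /job index_uniq ?size_map ?size_iota // map_inj_in_uniq ?iota_uniq //.
by move=> a b; rewrite !mem_iota => an bn; apply: sg_inj; lia.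
Qed.

(** An injection of the n jobs into the n slots leaves no slot empty. *)
Lemma job_ltn h : h < n -> job h < n.
Proof.
move=> hn; rewrite -[X in _ < X](size_iota 0) -(size_map sg) index_mem.
have u : uniq (map sg (iota 0 n)).
  rewrite map_inj_in_uniq ?iota_uniq // => a b; rewrite !mem_iota => an bn.
  by apply: sg_inj; lia.
have sub : {subset map sg (iota 0 n) <= iota 0 n}.
  by move=> h' /mapP[y]; rewrite mem_iota => yn ->; rewrite mem_iota; apply: sg_ltn.
have le : size (iota 0 n) <= size (map sg (iota 0 n)) by rewrite size_map.
by rewrite (uniq_min_size u sub le).2 mem_iota.
Qed.

Lemma sg_job h : h < n -> sg (job h) = h.
Proof.
move=> hn; have jn := job_ltn hn.
have -> : sg (job h) = nth 0 (map sg (iota 0 n)) (job h).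
  by rewrite (nth_map 0) ?size_iota // nth_iota.
rewrite nth_index //; move: jn; rewrite /job -[X in _ < X](size_iota 0) -(size_map sg).
by rewrite -index_mem size_map size_iota.
Qed.

Lemma job_slot h : h < n ->
  [/\ lo (job h) <= h, h < e (job h) & h.+1 < n -> h.+1 < e (job h)].
Proof.
move=> hn; have jn := job_ltn hn; have := sg_lo jn; have := sg_hi jn.
by rewrite !sg_job // => -[].
Qed.

Lemma job_inj h k : h < n -> k < n -> job h = job k -> h = k.
Proof. by move=> hn kn E; rewrite -(sg_job hn) E sg_job. Qed.

(* By Hall's bound on the jobs released after g, at least g + 2 jobs are
   released up to g, and the slots up to g hold only g + 1 of them. *)
Lemma late_job g : g.+1 < n -> exists h, [/\ h < n, lo (job h) <= g & g < h].
Proof.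
move=> gn; pose a := (fun y => g < lo y).
have few : count a (iota 0 n) <= n - g.+2.
  have [gn2|gn2] := ltnP g.+2 n.
    have := hall gn2 (leqnn n) isT; congr (_ <= _); last by lia.
    apply: eq_in_count => y; rewrite mem_iota => yn; rewrite /a.
    by have := job_len yn; lia.
  rewrite (@eq_in_count _ _ pred0) ?count_pred0 // => y; rewrite mem_iota => yn.
  by rewrite /a /=; have := job_len yn; lia.
have [/hasP[y]|/hasPn none] := boolP (has (fun y => (lo y <= g) && (g < sg y)) (iota 0 n)).
  by rewrite mem_iota => yn /andP[? ?]; exists (sg y); rewrite job_sg ?sg_ltn.
have : size (map sg (filter (predC a) (iota 0 n))) <= size (iota 0 g.+1).
  apply: uniq_leq_size.
    rewrite map_inj_in_uniq ?filter_uniq ?iota_uniq // => x z.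
    by rewrite !mem_filter !mem_iota => xn zn; apply: sg_inj; lia.
  move=> h /mapP[y]; rewrite mem_filter => /andP[ay yn] ->.
  have := none y yn; rewrite mem_iota; move: ay; rewrite /a /=; lia.
have := count_predC a (iota 0 n); rewrite size_map size_filter !size_iota; lia.
Qed.

End Slots.
End Schedule.

(** * The two increasing paths *)

Section Sweep.

Variables (n : nat) (lo e s : nat -> nat).

(* x_i is coded by i and the job y by n + y, as in vcode. *)
Definition incident (x v : nat) := [&& x < n, n <= v & lo (v - n) <= x < e (v - n)].
Definition adjcode (u v : nat) := incident u v || incident v u.

Hypothesis s_slot : forall h, h < n ->
  [/\ lo (s h) <= h, h < e (s h) & h.+1 < n -> h.+1 < e (s h)].

Lemma adjcode_sym : symmetric adjcode.
Proof. by move=> u v; rewrite /adjcode orbC. Qed.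

Lemma adjcode_job x y : x < n -> lo y <= x < e y -> adjcode x (n + y).
Proof. by move=> xn xy; rewrite /adjcode /incident xn addKn xy leq_addr. Qed.

Lemma rev_sorted_adjcode T : sorted adjcode (rev T) = sorted adjcode T.
Proof. by rewrite rev_sorted; apply: eq_sorted => u v; rewrite adjcode_sym. Qed.

(* The two paths, joined at x_0, just before x_g is visited: T runs from the spare
   job, in slot sp, to the job through which x_g will be entered. *)
Definition sweep g sp T :=
  [/\ sorted adjcode T, head 0 T = n + s sp, adjcode (last 0 T) g
    & perm_eq T (iota 0 g ++ [seq n + s h | h <- sp :: iota 0 g])].

Lemma sweep0 sp : 1 < n -> sp < n -> lo (s sp) = 0 -> sweep 0 sp [:: n + s sp].
Proof.
move=> n1 spn lo0; split=> //=.
rewrite adjcode_sym adjcode_job ?lo0 //; first by lia.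
by have [_ h _] := s_slot spn; lia.
Qed.

Lemma sorted_extend T a b : T != [::] -> sorted adjcode T -> adjcode (last 0 T) a ->
  adjcode a b -> sorted adjcode (T ++ [:: a; b]).
Proof. by case: T => // t T _ /=; rewrite cat_path => -> /= -> ->. Qed.

Lemma sweep_neq0 g sp T : sweep g sp T -> T != [::].
Proof. by case=> _ _ _ /perm_size; case: T => //; rewrite size_cat /= addnS. Qed.

Lemma adjcode_slot h : h < n -> adjcode h (n + s h).
Proof. by move=> hn; apply: adjcode_job => //; have [-> ->] := s_slot hn. Qed.

Lemma adjcode_slotS h : h.+1 < n -> adjcode (n + s h) h.+1.
Proof.
move=> hn; rewrite adjcode_sym; apply: adjcode_job => //.
by have [h1 _ h2] := s_slot (ltnW hn); rewrite h2 // leqW.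
Qed.

(** With the spare job in a later slot, the path goes on through [s g], which still reaches x_(g+1)
    because [g.+1 < n]. *)
Lemma sweep_keep g sp T : sweep g sp T -> g < sp < n ->
  sweep g.+1 sp (T ++ [:: g; n + s g]).
Proof.
move=> swT gsp; have T0 := sweep_neq0 swT; case: swT => so he la pe.
split.
- by apply: sorted_extend => //; apply: adjcode_slot; lia.
- by case: T T0 he {so la pe}.
- by rewrite last_cat /=; apply: adjcode_slotS; lia.
- rewrite -addn1 iotaD add0n /= map_cat.
  apply: perm_trans (perm_cat pe (perm_refl _)) _.
  apply/permP => a; rewrite /= !(count_cat, count_map) /= !count_cat /=.
  lia.
Qed.

(** The head of [T] is here [s g] itself, so reversing the extended path puts [s g] at the end that
    enters x_(g+1), and [s b] becomes the spare head. *)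
Lemma sweep_switch g b T : sweep g g T -> g < b < n -> lo (s b) <= g ->
  sweep g.+1 b (rev (T ++ [:: g; n + s b])).
Proof.
move=> swT gb lob; have T0 := sweep_neq0 swT; case: swT => so he la pe.
have [_ bE _] := @s_slot b ltac:(lia).
split.
- rewrite rev_sorted_adjcode; apply: sorted_extend => //.
  by apply: adjcode_job; lia.
- by rewrite rev_cat.
- rewrite rev_cat /=; case: T T0 he {so la pe} => // t T _ /= ->.
  by rewrite rev_cons last_rcons; apply: adjcode_slotS; lia.
- rewrite perm_rev -addn1 iotaD add0n /= map_cat.
  apply: perm_trans (perm_cat pe (perm_refl _)) _.
  apply/permP => a; rewrite /= !(count_cat, count_map) /= !count_cat /=.
  lia.
Qed.

(** The spare job is now in slot [n.-1], so both ends of [T] are adjacent to the last vertex. The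
    reversed cycle is included because memory may hold either orientation. *)
Lemma sweep_cycle T : 0 < n -> sweep n.-1 n.-1 T ->
  [/\ cycle adjcode (rcons T n.-1), cycle adjcode (rcons (rev T) n.-1)
    & perm_eq T (iota 0 n.-1 ++ [seq n + s h | h <- iota 0 n])].
Proof.
move=> n0 swT; have T0 := sweep_neq0 swT; case: swT => so he la pe.
have cyc : cycle adjcode (rcons T n.-1).
  case: T T0 so he la {pe} => // t T _ /= so he la.
  rewrite !rcons_path last_rcons so la he.
  by apply: adjcode_slot; lia.
split=> //.
  have E : (fun x => adjcode^~ x) =2 adjcode by move=> u v; rewrite adjcode_sym.
  by rewrite -rev_cons rev_cycle (eq_cycle E) -(rot_cycle 1) rot1_cons.
apply: perm_trans pe _; rewrite perm_cat2l -[in iota 0 n](prednK n0) -addn1 iotaD.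
by rewrite map_cat /= perm_sym cats1 perm_rcons.
Qed.

End Sweep.

Lemma perm_codes n s T : 0 < n -> (forall h, h < n -> s h < n) ->
  (forall h k, h < n -> k < n -> s h = s k -> h = k) ->
  perm_eq T (iota 0 n.-1 ++ [seq n + s h | h <- iota 0 n]) ->
  perm_eq (rcons T n.-1) (iota 0 (n + n)).
Proof.
move=> n0 s_ltn s_inj pe.
have ps : perm_eq [seq s h | h <- iota 0 n] (iota 0 n).
  have u : uniq [seq s h | h <- iota 0 n].
    rewrite map_inj_in_uniq ?iota_uniq // => h k; rewrite !mem_iota => hn kn.
    by apply: s_inj; lia.
  apply: uniq_perm; rewrite ?iota_uniq //.
  apply: (uniq_min_size u _ _).2; last by rewrite size_map.
  by move=> y /mapP[h]; rewrite !mem_iota => hn ->; apply: s_ltn.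
rewrite perm_rcons iotaD add0n -[in iota 0 n](prednK n0) -addn1 iotaD.
apply: perm_trans (_ : perm_eq ((n.-1 :: iota 0 n.-1) ++ [seq n + s h | h <- iota 0 n]) _).
  by rewrite /= perm_cons.
apply: perm_cat; first by rewrite perm_sym cats1 perm_rcons.
rewrite -[X in perm_eq _ (iota X _)]addn0 iotaDl.
by rewrite (map_comp (addn n) s) perm_map.
Qed.

(** * Runs of the machine *)

(* t is the time on the clock when c starts; Q receives the time when it halts. *)
Definition run W c t s (Q : nat -> state -> Prop) :=
  exists t' s', exec W c s t' s' /\ Q (t + t') s'.

Local Notation St l m := (State (nth 0 l) m).

(** Registers form a list padded with 0, so that the effect of an assignment on an explicit state
    computes. *)
Lemma run_assign W r e t l m (Q : nat -> state -> Prop) :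
  fits W (St l m) e ->
  Q (t + (cost e).+1) (St (set_nth 0 l r (eval (St l m) e)) m) ->
  run W (Assign r e) t (St l m) Q.
Proof.
move=> fe q; eexists _, _; split; first exact: ExecAssign.
rewrite (_ : upd _ _ _ = nth 0 (set_nth 0 l r (eval (St l m) e))) //.
by apply: functional_extensionality => i; rewrite nth_set_nth.
Qed.

Lemma run_store W e1 e2 t s (Q : nat -> state -> Prop) :
  fits W s e1 -> fits W s e2 ->
  Q (t + (cost e1 + cost e2).+1) (State (reg s) (upd (cell s) (eval s e1) (eval s e2))) ->
  run W (Store e1 e2) t s Q.
Proof. by move=> f1 f2 q; eexists _, _; split; first exact: ExecStore. Qed.

Lemma run_skip W t s (Q : nat -> state -> Prop) : Q t.+1 s -> run W Skip t s Q.
Proof. by move=> q; exists 1, s; rewrite addn1; split=> //; apply: ExecSkip. Qed.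

Lemma run_seq W c1 c2 t s Q :
  run W c1 t s (fun t1 s1 => run W c2 t1 s1 Q) -> run W (Seq c1 c2) t s Q.
Proof.
case=> t1 [s1 [ex1 [t2 [s2 [ex2 q]]]]]; exists (t1 + t2), s2.
by rewrite addnA; split=> //; apply: ExecSeq ex1 ex2.
Qed.

Lemma run_if W e c1 c2 t s Q :
  fits W s e ->
  (eval s e != 0 -> run W c1 (t + (cost e).+1) s Q) ->
  (eval s e = 0 -> run W c2 (t + (cost e).+1) s Q) ->
  run W (If e c1 c2) t s Q.
Proof.
move=> fe q1 q2.
have [t' [s' [ex q]]] : run W (if eval s e != 0 then c1 else c2) (t + (cost e).+1) s Q.
  by case: ifPn => [/q1//|]; rewrite negbK => /eqP/q2.
by exists ((cost e).+1 + t'), s'; rewrite addnA; split=> //; apply: ExecIf.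
Qed.

(* Every iteration takes time, so an invariant J that bounds the elapsed time
   also forces termination. *)
Lemma run_while (J : nat -> state -> Prop) B W e c t s Q :
  J t s ->
  (forall t s, J t s -> t <= B /\ fits W s e) ->
  (forall t s, J t s -> eval s e != 0 -> run W c (t + (cost e).+1) s J) ->
  (forall t s, J t s -> eval s e = 0 -> Q (t + (cost e).+1) s) ->
  run W (While e c) t s Q.
Proof.
move=> + JB Jc Jq.
have [k] := ubnP (B.+1 - t); elim: k => // k IHk in t s *; rewrite ltnS => le_k Js.
have [tB fe] := JB _ _ Js.
have [e0|e1] := eqVneq (eval s e) 0.
  exists (cost e).+1, s; split; last exact: Jq.
  exact: ExecWhileStop.
have [t1 [s1 [ex1 J1]]] := Jc _ _ Js e1.
have [t1B _] := JB _ _ J1.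
have [|t2 [s2 [ex2 q]]] := IHk _ _ _ J1; first by lia.
exists ((cost e).+1 + t1 + t2), s2; split; last by move: q; rewrite !addnA.
exact: ExecWhileStep ex1 ex2.
Qed.

Lemma run_weaken W c t s (Q Q' : nat -> state -> Prop) :
  run W c t s Q -> (forall t s, Q t s -> Q' t s) -> run W c t s Q'.
Proof. by case=> t' [s' [ex q]] QQ; exists t', s'; split=> //; apply: QQ. Qed.

Local Notation "c1 ;; c2" := (Seq c1 c2) (at level 90, right associativity).
Local Notation "r ::= e" := (Assign r e) (at level 70).
Local Notation "$ r" := (Reg r) (at level 5, r at level 0).
Local Notation "# k" := (Const k) (at level 5, k at level 0).
Local Notation "e1 [+] e2" := (Add e1 e2) (at level 50, left associativity).
Local Notation "e1 [-] e2" := (Defs.Sub e1 e2) (at level 50, left associativity).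
Local Notation "! e" := (Fetch e) (at level 5, e at level 4).

Local Ltac assign := apply: run_assign; [rewrite /=; try by lia | rewrite /=].
Local Ltac store := apply: run_store; [rewrite /=; try by lia | rewrite /=; try by lia | rewrite /=].
Local Ltac sassign := apply: run_seq; assign.
Local Ltac sstore := apply: run_seq; store.

(* Registers: 2 holds n, 3 the address of the block of the current job, 4 its index.
   The block (degree, neighbours) of the job y, at address ad y, has at least three
   words; they are overwritten by e y, lo y and n + y. *)
Definition min_loop : com :=
  While ($5 [-] $6)
    (8 ::= !($3 [+] #1 [+] $6) ;;
     If ($7 [-] $8) (7 ::= $8) Skip ;;
     6 ::= $6 [+] #1).

Definition records : com :=
  2 ::= !(#0) ;;
  3 ::= #2 ;;
  While ($2 [-] $4)
    (5 ::= !($3) ;;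
     7 ::= !($3 [+] #1) ;;
     6 ::= #1 ;;
     min_loop ;;
     Store $3 ($7 [+] $5) ;;
     Store ($3 [+] #1) $7 ;;
     Store ($3 [+] #2) ($2 [+] $4) ;;
     3 ::= $3 [+] $5 [+] #1 ;;
     4 ::= $4 [+] #1).

(* Register 9 holds the end M of the input; cell M + h is slot h and contains the
   address of its job, or 0 if it is free.  Register 5 is the job being inserted
   and register 6 the address of the slot it is compared with. *)
Definition probe_loop : com :=
  While (!($6))
    (7 ::= !($6) ;;
     If (!($7) [-] !($5)) (Store $6 $5 ;; 5 ::= $7) Skip ;;
     6 ::= $6 [+] #1).

Definition schedule : com :=
  9 ::= $3 ;;
  3 ::= #2 ;;
  4 ::= #0 ;;
  While ($2 [-] $4)
    (5 ::= $3 ;;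
     6 ::= $9 [+] !($3 [+] #1) ;;
     3 ::= $3 [+] (!($3) [-] !($3 [+] #1)) [+] #1 ;;
     4 ::= $4 [+] #1 ;;
     probe_loop ;;
     Store $6 $5).

(** * Amortised cost of the insertions *)

Section Delay.

Variable lo : nat -> nat.

(* The potential that pays for the iterations of probe_loop. *)
Definition delay k (sg : nat -> nat) := \sum_(i < k) (sg i - lo i).

Lemma delayS k sg : delay k.+1 sg = delay k sg + (sg k - lo k).
Proof. exact: big_ord_recr. Qed.

Lemma delay_insert k sg : delay k.+1 (upd sg k (lo k)) = delay k sg.
Proof.
rewrite delayS upd_same subnn addn0.
by apply: eq_bigr => i _; rewrite upd_other //; have := ltn_ord i; lia.
Qed.

Lemma delay_step k z sg : z < k -> lo z <= sg z ->
  delay k (upd sg z (sg z).+1) = (delay k sg).+1.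
Proof.
move=> zk lz; rewrite /delay (bigD1 (Ordinal zk)) //= [in RHS](bigD1 (Ordinal zk)) //=.
rewrite upd_same subSn // addSn.
congr (_ + _).+1; apply: eq_bigr => i /eqP iz; rewrite upd_other // => E.
by apply: iz; apply: val_inj.
Qed.

End Delay.

(** * Correctness and running time of [records] and [schedule] *)

Section Layout.

Variables (W n : nat) (T : nat -> seq nat) (lo ad : nat -> nat).
Local Notation d y := (size (T y)).
Local Notation e y := (lo y + d y).
Hypothesis adS : forall y, y < n -> ad y.+1 = ad y + d y + 1.

Lemma ad_lt y k : y < k -> k <= n -> ad y + d y + 1 <= ad k.
Proof.
elim: k => // k IHk; rewrite ltnS leq_eqVlt => /orP[/eqP->|yk] kn.
  by rewrite adS.
by have := IHk yk (ltnW kn); rewrite adS //; lia.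
Qed.

Hypothesis ad0 : ad 0 = 2.
Hypothesis T_size : forall y, y < n -> 1 < d y.

Lemma ad_gt1 y : y <= n -> 1 < ad y.
Proof. by case: y => [|y] yn; [rewrite ad0 | rewrite adS //; have := T_size yn; lia]. Qed.

Hypothesis T_mem : forall y, y < n -> T y =i iota (lo y) (d y).
Hypothesis e_le : forall y, y < n -> e y <= n.
Hypothesis W_large : ad n + 10 * n + 10 <= W.

Definition listed y (m : nat -> nat) :=
  m (ad y) = d y /\ forall j, j < d y -> m (ad y + 1 + j) = nth 0 (T y) j.

Definition record y (m : nat -> nat) :=
  [/\ m (ad y) = e y, m (ad y + 1) = lo y & m (ad y + 2) = n + y].

(** The zero words from [ad n] on later serve as empty slots. *)
Definition partial k m :=
  [/\ forall y, y < k -> record y m, forall y, k <= y < n -> listed y m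
    & forall a, ad n <= a -> m a = 0].

(** The degree is at least 2, so the record stays within block [k] and the blocks not yet read
    survive. *)
Lemma partialS k m : k < n -> partial k m ->
  partial k.+1 (upd (upd (upd m (ad k) (e k)) (ad k + 1) (lo k)) (ad k + 2) (n + k)).
Proof.
move=> kn [mr ml m0]; have dk := T_size kn; have := ad_lt (ltnSn k) kn; rewrite adS // => adk.
split=> [y|y yk|a an].
- rewrite ltnS leq_eqVlt => /orP[/eqP->|yk].
    split; last by rewrite upd_same.
      by do 2! (rewrite upd_other; last by lia); rewrite upd_same.
    by rewrite upd_other ?upd_same //; lia.
  have yad := ad_lt yk (ltnW kn); have dy := T_size (ltn_trans yk kn); have [? ? ?] := mr y yk.
  by split; do 3! (rewrite upd_other; last by lia).
- have [|ml0 ml1] := ml y; first by lia.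
  have yad : ad k + d k + 1 <= ad y by apply: ad_lt; lia.
  split=> [|j jd]; do 3! (rewrite upd_other; last by lia); first by [].
  exact: ml1.
- have kad : ad k + d k + 1 <= ad n by apply: ad_lt; lia.
  by do 3! (rewrite upd_other; last by lia); apply: m0.
Qed.

Lemma run_min_loop t k m x8 (Q : nat -> state -> Prop) : k < n -> listed k m ->
  (forall t' y8, t' <= t + 25 * d k ->
    Q t' (St [:: 0; 0; n; ad k; k; d k; d k; lo k; y8] m)) ->
  run W min_loop t (St [:: 0; 0; n; ad k; k; d k; 1; m (ad k + 1); x8] m) Q.
Proof.
move=> kn [mk0 mk1] HQ; have dk := T_size kn; have ek := e_le kn.
have adk := ad_lt kn (leqnn n).
have nT j : j < d k -> nth 0 (T k) j \in T k by apply: mem_nth.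
have bound x : x \in T k -> lo k <= x < e k by rewrite T_mem // mem_iota.
(* Register 7 holds a neighbour that is minimal among the first [j]; 21 is the most that one
   iteration costs. *)
pose J t' s := exists j l y8, [/\ s = St [:: 0; 0; n; ad k; k; d k; j; l; y8] m,
  0 < j <= d k, l \in T k, forall i, i < j -> l <= nth 0 (T k) i & t' + 21 <= t + 21 * j].
apply: (run_while (J := J) (B := t + 25 * d k)).
- exists 1, (m (ad k + 1)), x8; split=> //; first by lia.
    by rewrite -[ad k + 1]addn0 mk1 ?nT //; lia.
  by move=> [|//] _; rewrite -[ad k + 1]addn0 mk1 //; lia.
- by move=> t' s [j [l [y8 [-> jd lT lmin tt]]]]; rewrite /=; have := bound l lT; lia.
- move=> t' s [j [l [y8 [-> jd lT lmin tt]]]]; rewrite /= => jne.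
  have jd' : j < d k by lia.
  have mj := mk1 j jd'; have njT := nT j jd'.
  have nb := bound _ njT; have lb := bound _ lT.
  apply: run_seq; apply: run_assign; rewrite /= mj; first by lia.
  apply: run_seq; apply: run_if; rewrite /=; first by lia.
    move=> jl; assign; assign; eexists j.+1, _, _; split; rewrite ?addn1 //; try by lia.
    move=> i; rewrite ltnS leq_eqVlt => /orP[/eqP->//|ij].
    by have := lmin i ij; lia.
  move=> jl; apply: run_skip; assign; eexists j.+1, _, _; split; rewrite ?addn1 //; try by lia.
  by move=> i; rewrite ltnS leq_eqVlt => /orP[/eqP->|ij]; [lia | apply: lmin].
- move=> t' s [j [l [y8 [-> jd lT lmin tt]]]]; rewrite /= => je.
  have jE : j = d k by lia.
  have lE : l = lo k.
    have loT : lo k \in T k by rewrite T_mem // mem_iota; lia.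
    have := lmin (index (lo k) (T k)); rewrite jE index_mem nth_index // => /(_ loT).
    by have := bound l lT; lia.
  by rewrite jE lE; apply: HQ; lia.
Qed.

Lemma run_records m : m 0 = n -> partial 0 m ->
  run W records 0 (St [:: 0; 0; 0; 0; 0; 0; 0; 0; 0] m)
    (fun t s => exists m' x5 x6 x7 x8,
      [/\ s = St [:: 0; 0; n; ad n; n; x5; x6; x7; x8] m',
        partial n m' & t <= 100 * ad n]).
Proof.
move=> m0 pm; have adn := ad_gt1 (leqnn n).
sassign. rewrite m0. sassign.
(* Each input word before block [k] is worth 100 steps. The two header words cover the prologue and
   the final test. *)
pose J t s := exists k m' x5 x6 x7 x8,
      [/\ s = St [:: 0; 0; n; ad k; k; x5; x6; x7; x8] m', k <= n,
        partial k m' & t + 100 <= 100 * ad k].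
apply: (run_while (J := J) (B := 100 * ad n)).
- by exists 0, m, 0, 0, 0, 0; split=> //; rewrite ?ad0.
- move=> t s [k [m' [x5 [x6 [x7 [x8 [-> kn pk tt]]]]]]]; rewrite /=; split; last by lia.
  move: kn; rewrite leq_eqVlt => /orP[/eqP <-|kn]; first by lia.
  by have := ad_lt kn (leqnn n); lia.
- move=> t s [k [m' [x5 [x6 [x7 [x8 [-> kn pk tt]]]]]]]; rewrite /= => kne.
  have {}kn : k < n by lia.
  have adk := ad_lt kn (leqnn n); have dk := T_size kn; have ek := e_le kn.
  have lk : listed k m' by case: pk => _ H _; apply: H; lia.
  have [lk0 lk1] := lk.
  have lk1' : m' (ad k + 1) < n.
    rewrite -[ad k + 1]addn0 lk1; last by lia.
    have : nth 0 (T k) 0 \in T k by apply: mem_nth; apply: ltnW.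
    by rewrite T_mem // mem_iota; lia.
  apply: run_seq; apply: run_assign; rewrite /= lk0; first by lia.
  sassign. sassign.
  apply: run_seq; apply: run_min_loop => // t' y8 t't.
  sstore. sstore. sstore. sassign. assign.
  eexists k.+1, _, _, _, _, _; split; first by rewrite adS // -(addn1 k).
  + by [].
  + exact: partialS.
  + rewrite adS //; lia.
- move=> t s [k [m' [x5 [x6 [x7 [x8 [-> kn pk tt]]]]]]]; rewrite /= => kn'.
  have kE : k = n by lia.
  by subst k; exists m', x5, x6, x7, x8; split=> //; lia.
Qed.

Hypothesis hall : forall p q, p.+1 < q -> q <= n -> (0 < p) || (q < n) ->
  count (fun y => (p <= lo y) && (lo y + d y <= q)) (iota 0 n) <= (q - p).-1.

Let job_len y : y < n -> lo y + 2 <= e y <= n.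
Proof. by move=> yn; have := T_size yn; have := e_le yn; lia. Qed.

Local Notation edf := (edf lo (fun y => lo y + d y)).

Let bound k c sg y : k <= n -> edf k c sg -> y < k -> sg y < e y.
Proof. by move=> kn E yk; have [] := edf_bound job_len hall kn E yk. Qed.

Let lt_n k c sg y : k <= n -> edf k c sg -> y < k -> sg y < n.
Proof.
move=> kn E yk; have := bound kn E yk; have := e_le (leq_trans yk kn).
lia.
Qed.

(** A job is delayed by less than its degree, hence by less than the length of its block. This makes
    the total time linear. *)
Lemma delay_bound k sg : k <= n -> (forall y, y < k -> sg y < e y) -> delay lo k sg <= ad k.
Proof.
elim: k => [|k IHk] kn H; first by rewrite /delay big_ord0.
rewrite delayS adS //.
have := IHk (ltnW kn) (fun y yk => H y (leqW yk)); have := H k (ltnSn k); lia.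
Qed.

(** The word 0 is free to mark an empty slot, since block addresses start at 2. *)
Definition slots k c sg (m : nat -> nat) :=
  [/\ forall y, y < n -> record y m,
      forall y, y < k -> y != c -> m (ad n + sg y) = ad y,
      forall h, h < n -> m (ad n + h) <> 0 -> exists y, [/\ y < k, y != c & sg y = h]
    & forall a, ad n + n <= a -> m a = 0].

Lemma record_upd a v y m : y < n -> ad n <= a -> record y m ->
  record y (upd m a v).
Proof.
move=> yn an [r0 r1 r2]; have := ad_lt yn (leqnn n); have := T_size yn => dy ady.
by split; rewrite upd_other //; lia.
Qed.

Lemma slots_insert k sg m : k < n -> slots k k sg m -> slots k.+1 k (upd sg k (lo k)) m.
Proof.
move=> kn [mr ms mf m0]; split=> // [y yk yc|h hn mh].
  rewrite upd_other; last by lia.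
  by apply: ms; lia.
by have [y [yk yc yh]] := mf h hn mh; exists y; split; rewrite ?upd_other //; lia.
Qed.

Lemma slots_skip k c sg v m : slots k c sg m -> slots k c (upd sg c v) m.
Proof.
move=> [mr ms mf m0]; split=> // [y yk yc|h hn mh].
  by rewrite upd_other; [apply: ms | apply/eqP].
have [y [yk yc yh]] := mf h hn mh; exists y; split=> //.
by rewrite upd_other //; apply/eqP.
Qed.

Lemma slots_place k c sg m : k <= n -> c < k -> edf k c sg -> slots k c sg m ->
  (forall z, z < k -> z != c -> sg z <> sg c) ->
  slots k k sg (upd m (ad n + sg c) (ad c)).
Proof.
move=> kn ck E [mr ms mf m0] free; have cn := lt_n kn E ck.
split=> [y yn|y yk _|h hn|a an].
- by apply: record_upd; [| lia | apply: mr].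
- have [->|yc] := eqVneq y c; first by rewrite upd_same.
  rewrite upd_other ?ms //; have := free y yk yc; lia.
- have [->|hc] := eqVneq h (sg c); first by exists c; split=> //; lia.
  rewrite upd_other; last by move: hc => /eqP; lia.
  by move=> mh; have [y [yk yc yh]] := mf h hn mh; exists y; split=> //; lia.
- rewrite upd_other ?m0 //; lia.
Qed.

Lemma slots_swap k c z sg m : k <= n -> c < k -> edf k c sg -> slots k c sg m ->
  z < k -> z != c -> sg z = sg c ->
  slots k z (upd sg z (sg z).+1) (upd m (ad n + sg c) (ad c)).
Proof.
move=> kn ck E [mr ms mf m0] zk zc zh; have cn := lt_n kn E ck; have [_ inj _] := E.
split=> [y yn|y yk yz|h hn|a an].
- by apply: record_upd; [| lia | apply: mr].
- rewrite (@upd_other sg z); last by apply/eqP.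
  have [->|yc] := eqVneq y c; first by rewrite upd_same.
  rewrite upd_other ?ms // => /addnI yh.
  by case/eqP: yz; apply: inj => //; rewrite zh.
- have [->|hc] := eqVneq h (sg c).
    exists c; split=> //; first by rewrite eq_sym.
    by rewrite upd_other //; apply/eqP; rewrite eq_sym.
  rewrite upd_other; last by move: hc => /eqP; lia.
  move=> mh; have [y [yk yc yh]] := mf h hn mh; have [yz|yz] := eqVneq y z.
    by case/eqP: hc; rewrite -yh yz.
  by exists y; rewrite upd_other //; apply/eqP.
- rewrite upd_other ?m0 //; lia.
Qed.

(** Every iteration raises [delay] by one and takes at most 25 steps, so time is charged to the
    growth of [delay]. The write into the free slot is left to the caller, so the continuation sees
    it as a pending update. *)
Lemma run_probe_loop t k c sg m x7 x8 a (Q : nat -> state -> Prop) :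
  k <= n -> c < k -> edf k c sg -> slots k c sg m -> a <= ad n ->
  (forall t' c' sg' m' y7, c' < k -> edf k c' sg' -> edf k k sg' ->
    slots k k sg' (upd m' (ad n + sg' c') (ad c')) ->
    t' + 25 * delay lo k sg <= t + 5 + 25 * delay lo k sg' ->
    Q t' (St [:: 0; 0; n; a; k; ad c'; ad n + sg' c'; y7; x8; ad n] m')) ->
  run W probe_loop t (St [:: 0; 0; n; a; k; ad c; ad n + sg c; x7; x8; ad n] m) Q.
Proof.
move=> kn ck0 E0 S0 an HQ; have adn := ad_gt1 (leqnn n).
pose J t' s := exists c' sg' m' y7,
  [/\ s = St [:: 0; 0; n; a; k; ad c'; ad n + sg' c'; y7; x8; ad n] m',
      c' < k, edf k c' sg', slots k c' sg' m'
    & t' + 25 * delay lo k sg <= t + 25 * delay lo k sg'].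
have job_read y m' : y < k -> (forall y, y < n -> record y m') ->
    [/\ m' (ad y) = e y, e y <= n & 0 < ad y <= ad n].
  move=> yk mr; have yn := leq_trans yk kn; have [-> _ _] := mr y yn.
  by have := ad_gt1 (ltnW yn); have := ad_lt yn (leqnn n); have := e_le yn; split=> //; lia.
have place_read c' sg' m' : c' < k -> edf k c' sg' -> slots k c' sg' m' ->
    m' (ad n + sg' c') <> 0 ->
    exists z, [/\ z < k, z != c', sg' z = sg' c' & m' (ad n + sg' c') = ad z].
  move=> ck E [mr ms mf m0] ne; have [z [zk zc zh]] := mf _ (lt_n kn E ck) ne.
  by exists z; split=> //; rewrite -zh ms.
(* Since [delay] never exceeds [ad n], this bounds the clock and forces the loop to stop at a free
   slot. *)
apply: (run_while (J := J) (B := t + 25 * ad n)).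
- by exists c, sg, m, x7.
- move=> t' s [c' [sg' [m' [y7 [-> ck E S tt]]]]] /=.
  have db : delay lo k sg' <= ad n.
    apply: leq_trans (delay_bound kn _) _; first by move=> y; apply: bound E.
    move: kn; rewrite leq_eqVlt => /orP[/eqP->//|kn'].
    by have := ad_lt kn' (leqnn n); lia.
  split; first by lia.
  have cn := lt_n kn E ck; have [e0|/eqP ne] := eqVneq (m' (ad n + sg' c')) 0; first by lia.
  have [z [zk _ _ mz]] := place_read _ _ _ ck E S ne; have [mr _ _ _] := S.
  have [_ _ zb] := job_read z m' zk mr; lia.
- move=> t' s [c' [sg' [m' [y7 [-> ck E S tt]]]]] /= /eqP ne.
  have cn := lt_n kn E ck; have [mr _ _ _] := S.
  have [z [zk zc zh mz]] := place_read _ _ _ ck E S ne.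
  have [mz1 ez zb] := job_read z m' zk mr; have [mc1 ec cb] := job_read c' m' ck mr.
  sassign; rewrite mz.
  apply: run_seq; apply: run_if; rewrite /= ?mz1 ?mc1; first by lia.
    move=> lt; sstore; assign; assign.
    eexists z, (upd sg' z (sg' z).+1), _, _; split.
    + by rewrite upd_same zh addn1 addnS.
    + by [].
    + by apply: edf_swap E ck zk zc zh _; lia.
    + exact: slots_swap.
    + rewrite delay_step //; first by lia.
      by have [L _ _] := E; apply: L.
  move=> ge; apply: run_skip; assign.
  eexists c', (upd sg' c' (sg' c').+1), _, _; split.
  + by rewrite upd_same addn1 addnS.
  + by [].
  + by apply: edf_skip E zk zc zh _; lia.
  + exact: slots_skip.
  + rewrite delay_step //; first by lia.
    by have [L _ _] := E; apply: L.
- move=> t' s [c' [sg' [m' [y7 [-> ck E S tt]]]]] /= e0.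
  have free z : z < k -> z != c' -> sg' z <> sg' c'.
    move=> zk zc zh; have [_ ms _ _] := S; have := ms z zk zc.
    by rewrite zh e0; have := ad_gt1 (ltnW (leq_trans zk kn)); lia.
  apply: HQ => //; last by lia.
  + exact: edf_place E free.
  + exact: slots_place.
Qed.

Lemma run_schedule t0 m x5 x6 x7 x8 (Q : nat -> state -> Prop) :
  partial n m ->
  (forall t sg m' y3 y5 y6 y7, edf n n sg -> slots n n sg m' ->
    t <= t0 + 25 * ad n + 100 * n + 20 ->
    Q t (St [:: 0; 0; n; y3; n; y5; y6; y7; x8; ad n] m')) ->
  run W schedule t0 (St [:: 0; 0; n; ad n; n; x5; x6; x7; x8] m) Q.
Proof.
move=> [mr _ m0] HQ; have adn := ad_gt1 (leqnn n).
sassign. sassign. sassign.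
pose J t s := exists k sg m' y5 y6 y7,
  [/\ s = St [:: 0; 0; n; ad k; k; y5; y6; y7; x8; ad n] m', k <= n,
      edf k k sg, slots k k sg m'
    & t <= t0 + 9 + 100 * k + 25 * delay lo k sg].
have J_time k sg : k <= n -> edf k k sg -> delay lo k sg <= ad n.
  move=> kn E; apply: leq_trans (delay_bound kn _) _; first by move=> y; apply: bound E.
  move: kn; rewrite leq_eqVlt => /orP[/eqP->//|kn'].
  by have := ad_lt kn' (leqnn n); lia.
apply: (run_while (J := J) (B := t0 + 9 + 100 * n + 25 * ad n)).
- exists 0, (fun _ => 0), m, x5, x6, x7; split=> //; first by rewrite ad0.
  + split=> // h hn; rewrite m0 //; lia.
  + rewrite /delay big_ord0; lia.
- move=> t s [k [sg [m' [y5 [y6 [y7 [-> kn E S tt]]]]]]] /=.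
  by have := J_time k sg kn E; split; lia.
- move=> t s [k [sg [m' [y5 [y6 [y7 [-> kn E S tt]]]]]]] /= kne.
  have {}kn : k < n by lia.
  have [mr' _ _ _] := S; have [mk0 mk1 mk2] := mr' k kn; have adk := ad_lt kn (leqnn n).
  have dk := T_size kn; have ek := e_le kn.
  sassign.
  apply: run_seq; apply: run_assign; rewrite /= ?mk1; first by lia.
  apply: run_seq; apply: run_assign; rewrite /= ?mk1 ?mk0; first by lia.
  sassign; apply: run_seq.
  (* The degree word has been overwritten by the deadline; deadline minus release time recovers the
     degree. *)
  rewrite (_ : ad k + _ + 1 = ad k.+1); last by rewrite adS //; lia.
  rewrite (addn1 k) -[in ad n + lo k](upd_same sg k (lo k)).
  apply: run_probe_loop => //.
  + exact: edf_insert.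
  + exact: slots_insert.
  + move: kn; rewrite leq_eqVlt => /orP[/eqP->//|kn'].
    by have := ad_lt kn' (leqnn n); lia.
  move=> t' c' sg' m2 z7 ck E1 E2 S2 tt'; have cn := lt_n kn E1 ck.
  have cad := ad_lt (leq_trans ck kn) (leqnn n).
  store.
  exists k.+1, sg'; eexists _, _, _, _; split=> //.
  by rewrite delay_insert in tt'; lia.
- move=> t s [k [sg [m' [y5 [y6 [y7 [-> kn E S tt]]]]]]] /= ke.
  have {ke} kE : k = n by lia.
  subst k; apply: (HQ _ sg) => //.
  by have := J_time n sg kn E; lia.
Qed.

End Layout.

(* Cell M + n + l receives the last slot whose job is released at l. *)
Definition index_slots : com :=
  4 ::= #0 ;;
  While ($2 [-] $4)
    (Store ($9 [+] $2 [+] !(!($9 [+] $4) [+] #1)) $4 ;;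
     4 ::= $4 [+] #1).

(* The vertices visited so far occupy the cells from register 7 up to register 6
   excluded, and this block grows at both ends: register 8 tells at which end the
   path that visits x_g is extended.  Register 4 is g, 5 the slot of the spare job,
   and 3 the last slot holding a job released by time g. *)
Definition emit : com :=
  If $8
    (Store ($7 [-] #1) $4 ;; 7 ::= $7 [-] #2 ;; Store $7 $0)
    (Store $6 $4 ;; Store ($6 [+] #1) $0 ;; 6 ::= $6 [+] #2) ;;
  8 ::= $1 ;;
  4 ::= $4 [+] #1.

Definition walk : com :=
  3 ::= !($9 [+] $2) ;;
  5 ::= $3 ;;
  7 ::= $9 [+] $2 [+] $2 [+] $2 [+] $2 ;;
  6 ::= $7 [+] #1 ;;
  Store $7 (!(!($9 [+] $3) [+] #2)) ;;
  8 ::= #0 ;;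
  4 ::= #0 ;;
  While ($2 [-] $4 [-] #1)
    (0 ::= !($9 [+] $2 [+] $4) ;;
     If ($0 [-] $3) (3 ::= $0) Skip ;;
     0 ::= $4 ;;
     1 ::= $8 ;;
     If ($5 [-] $4) Skip (0 ::= $3 ;; 5 ::= $3 ;; 1 ::= #1 [-] $8) ;;
     0 ::= !(!($9 [+] $0) [+] #2) ;;
     emit) ;;
  Store $6 ($2 [-] #1) ;;
  0 ::= $7 ;;
  1 ::= $2 [+] $2.

Definition block q (c : seq nat) (m : nat -> nat) := [seq m a | a <- iota q (size c)] = c.

Lemma block_out q c m a v : block q c m -> (a < q) || (q + size c <= a) ->
  block q c (upd m a v).
Proof.
move=> B out; rewrite /block -[RHS]B; apply/eq_in_map => i; rewrite mem_iota => iq.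
by rewrite upd_other //; lia.
Qed.

Lemma block_rcons q c m v : block q c m -> block q (rcons c v) (upd m (q + size c) v).
Proof.
move=> B; rewrite /block size_rcons -addn1 iotaD map_cat /= upd_same cats1.
by congr rcons; apply: block_out; rewrite ?leqnn ?orbT.
Qed.

Lemma block_cons q c m v : block q.+1 c m -> block q (v :: c) (upd m q v).
Proof.
move=> B; rewrite /block /= upd_same; congr (_ :: _).
by apply: block_out; rewrite ?ltnSn.
Qed.

(** * Correctness and running time of [index_slots] and [walk] *)

Section Walk.

Variables (W n M : nat) (lo e s ad : nat -> nat).
Hypothesis n_gt1 : 1 < n.
Hypothesis W_large : M + 10 * n + 10 <= W.
Hypothesis s_ltn : forall h, h < n -> s h < n.
Hypothesis s_slot : forall h, h < n ->
  [/\ lo (s h) <= h, h < e (s h) & h.+1 < n -> h.+1 < e (s h)].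
Hypothesis s_late : forall g, g.+1 < n -> exists h, [/\ h < n, lo (s h) <= g & g < h].
Hypothesis ad_small : forall h, h < n -> ad (s h) + 2 < M.

Local Notation sweep := (sweep n lo e s).

Definition stored (m : nat -> nat) := forall h, h < n ->
  [/\ m (M + h) = ad (s h), m (ad (s h) + 1) = lo (s h) & m (ad (s h) + 2) = n + s h].

Lemma stored_upd a v m : M + n <= a -> stored m -> stored (upd m a v).
Proof.
by move=> aM S h hn; have [? ? ?] := S h hn; have := ad_small hn => adM;
  split; rewrite upd_other //; lia.
Qed.

Let lo_ltn h : h < n -> lo (s h) < n.
Proof. by move=> hn; have [? _ _] := s_slot hn; lia. Qed.

(* The value 0 means either slot 0 or no slot at all. *)
Definition latest k (m : nat -> nat) := forall l, l < n ->
  (m (M + n + l) = 0 \/ m (M + n + l) < k /\ lo (s (m (M + n + l))) = l) /\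
  forall h, h < k -> lo (s h) = l -> h <= m (M + n + l).

Lemma latest_upd k a v m : M + n + n <= a -> latest k m -> latest k (upd m a v).
Proof. by move=> aM L l ln; rewrite upd_other; [apply: L | lia]. Qed.

(** Slots are scanned in increasing order, so a later write for the same release time is always the
    larger slot. *)
Lemma latestS k m : k < n -> latest k m -> latest k.+1 (upd m (M + n + lo (s k)) k).
Proof.
move=> kn L l ln; have [L1 L2] := L l ln.
have [->|ne] := eqVneq l (lo (s k)).
  rewrite upd_same; split; first by right.
  by move=> h; rewrite ltnS.
rewrite upd_other; last by move/eqP: ne; lia.
split; first by case: L1 => [|[]]; [left | right; split=> //; lia].
move=> h; rewrite ltnS leq_eqVlt => /orP[/eqP->|hk] lh; last exact: L2.
by rewrite lh eqxx in ne.
Qed.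

Lemma run_index_slots t m y3 y4 y5 y6 y7 y8 (Q : nat -> state -> Prop) :
  stored m -> (forall a, M + n <= a -> m a = 0) ->
  (forall t' m', t' <= t + 30 * n + 20 -> stored m' -> latest n m' ->
     Q t' (St [:: 0; 0; n; y3; n; y5; y6; y7; y8; M] m')) ->
  run W index_slots t (St [:: 0; 0; n; y3; y4; y5; y6; y7; y8; M] m) Q.
Proof.
move=> S m0 HQ; sassign.
pose J t' s := exists h m', [/\ s = St [:: 0; 0; n; y3; h; y5; y6; y7; y8; M] m',
  h <= n, stored m', latest h m' & t' <= t + 5 + 30 * h].
apply: (run_while (J := J) (B := t + 5 + 30 * n)).
- exists 0, m; split=> //; last by lia.
  by move=> l ln; split=> //; left; apply: m0; lia.
- by move=> t' st [h [m' [-> hn S' L tt]]] /=; lia.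
- move=> t' st [h [m' [-> hn S' L tt]]] /= hne.
  have {}hn : h < n by lia.
  have [mh mh1 _] := S' h hn; have adM := ad_small hn; have lon := lo_ltn hn.
  apply: run_seq; apply: run_store; rewrite /= ?mh ?mh1; try by lia.
  assign.
  exists h.+1; eexists; split; first by rewrite addn1.
  + by [].
  + by apply: stored_upd => //; lia.
  + exact: latestS.
  + by lia.
- move=> t' st [h [m' [-> hn S' L tt]]] /= he.
  have {he} hE : h = n by lia.
  by subst h; apply: HQ => //; lia.
Qed.

(** With the flag set the growing end is the low one, so memory holds [T] backwards. Reversing [T]
    thus costs only a flip of the flag. *)
Definition oriented (fl : bool) (T : seq nat) := if fl then rev T else T.

(** The extension follows the old flag [fl]; [fl'], prepared in register 1, takes effect only for
    the next vertex. *)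
Lemma run_emit t m v (fl fl' : bool) best sp g p q T (Q : nat -> state -> Prop) :
  block q (oriented fl T) m -> p = q + size T -> g < n -> v < n + n ->
  M + n + n + 2 <= q -> p + 2 <= M + 8 * n -> stored m -> latest n m ->
  (forall t' p' q' m', t' <= t + 40 ->
    block q' (oriented fl (T ++ [:: g; v])) m' -> p' = q' + size (T ++ [:: g; v]) ->
    q <= q' + 2 -> p' <= p + 2 -> stored m' -> latest n m' ->
    Q t' (St [:: v; fl' : nat; n; best; g.+1; sp; p'; q'; fl' : nat; M] m')) ->
  run W emit t (St [:: v; fl' : nat; n; best; g; sp; p; q; fl : nat; M] m) Q.
Proof.
move=> B pE gn vn qM pM S L HQ.
apply: run_seq; apply: run_if; rewrite /=; first by case: (fl); lia.
  case: fl B HQ => // B HQ _.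
  have qE : q = q.-2.+2 by lia.
  sstore. sassign. store. sassign. assign.
  rewrite (addn1 g); apply: HQ.
  - by lia.
  - have -> : q - 1 = q.-2.+1 by lia.
    have -> : q - 2 = q.-2 by lia.
    rewrite /oriented rev_cat.
    apply: block_cons.
    apply: block_cons.
    by rewrite -qE.
  - by rewrite size_cat /=; lia.
  - by lia.
  - by lia.
  - by do 2! (apply: stored_upd; first by lia).
  - by do 2! (apply: latest_upd; first by lia).
case: fl B HQ => // B HQ _.
sstore. sstore. assign. sassign. assign.
rewrite (addn1 g); apply: HQ.
- by lia.
- rewrite /oriented -cat_rcons cats1 pE.
  rewrite (_ : q + size T + 1 = q + size (rcons T g)) ?size_rcons; last by lia.
  rewrite -(size_rcons T g).
  by do 2! apply: block_rcons.
- by rewrite size_cat /=; lia.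
- by lia.
- by lia.
- by do 2! (apply: stored_upd; first by lia).
- by do 2! (apply: latest_upd; first by lia).
Qed.

Lemma run_walk t m y3 y4 y5 y6 y7 y8 :
  stored m -> latest n m ->
  run W walk t (St [:: 0; 0; n; y3; y4; y5; y6; y7; y8; M] m)
    (fun t' st => t' <= t + 200 * n + 100 /\ exists fl T,
       sweep n.-1 n.-1 T /\ output st = rcons (oriented fl T) n.-1).
Proof.
move=> S L.
(* [s_late] at 0 provides a positive slot with release time 0, so the entry read here is not the
   default 0. *)
have [F0 F1] : m (M + n) < n /\ lo (s (m (M + n))) = 0.
  have [L1 L2] := L 0 (ltnW n_gt1); rewrite addn0 in L1 L2.
  have [h [hn lh h0]] := s_late n_gt1.
  have := L2 h hn; case: L1; lia.
have [mF _ mF2] := S _ F0; have adF := ad_small F0; have sF := s_ltn F0.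
sassign. sassign. sassign. sassign.
apply: run_seq; apply: run_store; rewrite /= ?mF ?mF2; try by lia.
sassign. sassign.
set b0 := m (M + n); set q0 := M + n + n + n + n.
(* The block starts at M + 4n and grows by at most two cells per round at either end, so it stays
   clear of the tables below M + 2n. [best] need only dominate the slots of jobs released before
   [g]; those released at [g] are taken in during the round. *)
pose J t' st := exists x0 x1 best g sp p q (fl : bool) m' T,
  [/\ st = St [:: x0; x1; n; best; g; sp; p; q; fl : nat; M] m',
      [/\ sweep g sp T, g < n & g <= sp < n],
      [/\ best < n, lo (s best) <= g & forall h, h < n -> lo (s h) < g -> h <= best],
      [/\ block q (oriented fl T) m', stored m', latest n m', p = q + size T
        & (q0 <= q + 2 * g) && (p <= q0 + 2 * g + 1)]
    & t' <= t + 50 + 150 * g].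
apply: run_seq; apply: (run_while (J := J) (B := t + 50 + 150 * n)).
- exists 0, 0, b0, 0, b0, (q0 + 1), q0, false; eexists; exists [:: n + s b0].
  split; first by [].
  + by split; [apply: sweep0 | exact: ltnW |].
  + by split=> //; rewrite F1.
  + split=> //; try by lia.
    * by rewrite /block /= upd_same.
    * by apply: stored_upd => //; rewrite /q0; lia.
    * by apply: latest_upd => //; rewrite /q0; lia.
  + by lia.
- move=> t' st [x0 [x1 [best [g [sp [p [q [fl [m' [T [-> [sw gn spn] _ _ tt]]]]]]]]]]] /=.
  by lia.
- move=> t' st [x0 [x1 [best [g [sp [p [q [fl [m' [T [-> [sw gn spn] [bn blo bmax]
    [B S' L' pE /andP[qb pb]] tt]]]]]]]]]]] /= gne.
  have {}gn : g.+1 < n by lia.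
  have [L1 L2] := L' g (ltnW gn).
  have Fn : m' (M + n + g) < n by case: L1; lia.
  sassign.
  (* The new value is the maximum of [best] and the entry for [g]; an absent entry reads 0 and never
     wins. *)
  apply: run_seq; apply: (run_weaken (Q := fun t1 st1 => exists best', t1 <= t' + 25 /\
    [/\ st1 = St [:: m' (M + n + g); x1; n; best'; g; sp; p; q; fl : nat; M] m',
      best' < n, lo (s best') <= g & forall h, h < n -> lo (s h) <= g -> h <= best'])).
    have mx F : best <= F -> m' (M + n + g) <= F ->
        forall h, h < n -> lo (s h) <= g -> h <= F.
      move=> bF mF' h hn; rewrite leq_eqVlt => /orP[/eqP lh|lh].
        by have := L2 h hn lh; lia.
      by have := bmax h hn lh; lia.
    apply: run_if; rewrite /=; first by lia.
      move=> gt; assign; exists (m' (M + n + g)); split; first by lia.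
      by split=> //; [case: L1; lia | apply: mx; lia].
    move=> le; apply: run_skip; exists best; split; first by lia.
    by split=> //; apply: mx; lia.
  move=> t1 st1 [best' [tt1 [-> bn' blo' bmax']]].
  (* Some job released by [g] sits beyond slot [g], so [best'] qualifies as the next spare slot. *)
  have gb : g < best'.
    by have [h [hn lh gh]] := s_late gn; have := bmax' h hn lh; lia.
  sassign. sassign.
  (* The abstract path is reversed exactly when the flag changes; oriented by the new flag it is
     therefore the same block in memory. *)
  apply: run_seq; apply: (run_weaken (Q := fun t2 st2 => exists u sp' (fl' : bool), t2 <= t1 + 25 /\
    [/\ st2 = St [:: u; fl' : nat; n; best'; g; sp'; p; q; fl : nat; M] m',
      u < n, g.+1 <= sp' < n & sweep g.+1 sp' (oriented (fl' != fl) (T ++ [:: g; n + s u]))])).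
    apply: run_if; rewrite /=; first by lia.
      move=> gsp; apply: run_skip; exists g, sp, fl; split; first by lia.
      by rewrite eqxx; split=> //; [lia | lia | apply: sweep_keep => //; lia].
    move=> gsp; have {gsp} spE : sp = g by lia.
    subst sp; sassign; sassign; assign.
    exists best', best', (~~ fl); split; first by lia.
    split; [by case: (fl) | by [] | by lia |].
    rewrite (_ : (~~ fl != fl) = true); last by case: (fl).
    by apply: sweep_switch => //; lia.
  move=> t2 st2 [u [sp' [fl' [tt2 [-> un sp'n sw']]]]].
  have [mu _ mu2] := S' u un; have adu := ad_small un; have su := s_ltn un.
  apply: run_seq; apply: run_assign; rewrite /= ?mu ?mu2; first by lia.
  apply: (run_emit B pE) => //; rewrite ?/q0; try by rewrite /q0 in qb pb; lia.
  move=> t3 p' q' m3 tt3 B3 pE3 qq pp S3 L3.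
  exists (n + s u), fl', best', g.+1, sp', p', q', fl', m3.
  exists (oriented (fl' != fl) (T ++ [:: g; n + s u])).
  split=> //; last by lia.
  + by split=> //; lia.
  + move: B3 pE3; rewrite /oriented => B3 pE3; split=> //; try by lia.
    * by case: (fl') (fl) B3 => [] [] //=; rewrite ?revK.
    * by case: ifP; rewrite ?size_rev.
- move=> t' st [x0 [x1 [best [g [sp [p [q [fl [m' [T [-> [sw gn spn] [bn blo bmax]
    [B S' L' pE /andP[qb pb]] tt]]]]]]]]]]] /= ge.
  have gE : g = n.-1 by lia.
  have spE : sp = n.-1 by lia.
  subst g sp; rewrite /q0 in qb pb.
  sstore. sassign. assign.
  split; first by lia.
  exists fl, T; split=> //.
  have sz : n + n = size (rcons (oriented fl T) n.-1).
    case: sw => _ _ _ /perm_size; rewrite size_rcons /oriented.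
    by case: (fl); rewrite ?size_rev size_cat size_map /= size_iota => ->; lia.
  rewrite /output /= sz subn1 pE -(_ : size (oriented fl T) = size T).
    exact: block_rcons.
  by rewrite /oriented; case: (fl); rewrite ?size_rev.
Qed.

End Walk.

(** * Graphs with Property A *)

Lemma count_iota_card n (P : pred nat) : count P (iota 0 n) = #|[set i : 'I_n | P i]|.
Proof.
rewrite -sum1_card -sum1_count -{1}[n]subn0 big_mkord.
by apply: eq_bigl => i; rewrite inE.
Qed.

Lemma seq_extrema (s : seq nat) : s != [::] ->
  exists a b, [/\ a \in s, b \in s & forall x, x \in s -> a <= x <= b].
Proof.
elim: s => // x s IHs _; have [->|/IHs[a [b [as_ bs ab]]]] := eqVneq s [::].
  by exists x, x; rewrite mem_head; split=> // z; rewrite inE => /eqP->; rewrite leqnn.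
exists (minn x a), (maxn x b); split.
- by rewrite /minn; case: ifP; rewrite !inE ?eqxx ?as_ ?orbT.
- by rewrite /maxn; case: ifP; rewrite !inE ?eqxx ?bs ?orbT.
- move=> z; rewrite inE => /orP[/eqP->|/ab]; lia.
Qed.

(** The minimum, or 0 for the empty list. *)
Definition low (s : seq nat) := head 0 (sort leq s).

(** A convex set of naturals fills the range between its extrema, and its size then fixes the upper
    end. *)
Lemma low_interval (s : seq nat) : uniq s -> s != [::] ->
  (forall a b c, a <= b <= c -> a \in s -> c \in s -> b \in s) ->
  s =i iota (low s) (size s).
Proof.
move=> us s0 conv; have [a [b [as_ bs ab]]] := seq_extrema s0.
have sI : s =i iota a (b - a).+1.
  move=> x; rewrite mem_iota; apply/idP/idP => [/ab|xab]; first by lia.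
  by apply: (conv a x b) => //; have := ab b bs; lia.
have sz : size s = (b - a).+1.
  by have := perm_size (uniq_perm us (iota_uniq a _) sI); rewrite size_iota.
suff lowE : low s = a by rewrite lowE sz.
rewrite /low; have := sort_sorted leq_total s; have := mem_sort leq s.
case: (sort leq s) => [|x t] E pt; first by have := E a; rewrite as_.
rewrite /=.
have := E a; rewrite as_ inE => /orP[/eqP<- //|at_].
have xa : x <= a by have /allP := order_path_min leq_trans pt; apply.
have : x \in s by rewrite -E mem_head.
by move/ab; lia.
Qed.

(** * The jobs of a convex graph with Property A *)

Section Input.

Variables (G : bigraph) (L : 'I_(nY G) -> seq 'I_(nX G)).
Hypothesis connG : connected G.
Hypothesis convG : convex G.
Hypothesis propA : propertyA G.
Hypothesis adjL : adjacency_lists L.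

Local Notation n := (nX G).

(** Total on the naturals, because the scheduling part indexes jobs by [nat]. *)
Definition nbrs y : seq nat :=
  if insub y : option 'I_(nY G) is Some y' then [seq nat_of_ord x | x <- L y'] else [::].

Definition block_address y := 2 + size (flatten [seq size (nbrs z) :: nbrs z | z <- iota 0 y]).

Definition lows y := low (nbrs y).

Lemma nbrsE (y : 'I_(nY G)) : nbrs y = [seq nat_of_ord x | x <- L y].
Proof. by rewrite /nbrs valK. Qed.

Lemma mem_nbrs (x : 'I_n) (y : 'I_(nY G)) : (nat_of_ord x \in nbrs y) = adj x y.
Proof.
rewrite nbrsE mem_map; last exact: val_inj.
by rewrite (perm_mem (adjL y)) mem_enum inE.
Qed.

Lemma size_nbrs (y : 'I_(nY G)) : size (nbrs y) = #|nbr y|.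
Proof. by rewrite nbrsE size_map (perm_size (adjL y)) cardE. Qed.

Lemma nbrs_ltn y x : x \in nbrs y -> x < n.
Proof.
rewrite /nbrs; case: insubP => // y' _ _ /mapP[z _ ->]; exact: ltn_ord.
Qed.

Lemma Xint_full : Xint G 1 n = setT.
Proof. by apply/setP => x; rewrite !inE ltn_ord. Qed.

(** Every neighbourhood lies in the full interval, so the first count in part (3) is that of all of
    Y. *)
Lemma nY_nX : nY G = n.
Proof.
have [_ _ [<- _]] := propA; rewrite -[LHS]card_ord -cardsT.
by apply: eq_card => y; rewrite !inE Xint_full subsetT.
Qed.

(** The second count in part (3) equals |Y|, so no y is left out of it. *)
Lemma degree_gt1 (y : 'I_(nY G)) : 1 < #|nbr y|.
Proof.
have [_ _ [_ full]] := propA.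
have : NX' G 1 n = setT.
  by apply/eqP; rewrite eqEcard subsetT cardsT card_ord full nY_nX /=.
by move/setP/(_ y); rewrite !inE Xint_full setIT.
Qed.

Lemma nX_gt1 : 1 < n.
Proof.
have [V0 _] := connG.
have n0 : 0 < nY G.
  by move: V0; rewrite /vertex card_sum !card_ord -nY_nX addn_gt0 orbb.
apply: leq_trans (degree_gt1 (Ordinal n0)) _.
by rewrite -[leqRHS]card_ord max_card.
Qed.

Lemma size_nbrs_gt1 y : y < n -> 1 < size (nbrs y).
Proof.
rewrite -nY_nX => yn; have := degree_gt1 (Ordinal yn).
by rewrite -size_nbrs.
Qed.

Lemma nbrs_interval y : y < n -> nbrs y =i iota (lows y) (size (nbrs y)).
Proof.
rewrite -nY_nX => yn; pose y' := Ordinal yn; have -> : y = y' by [].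
apply: low_interval.
- rewrite nbrsE map_inj_uniq; last exact: val_inj.
  by rewrite (perm_uniq (adjL y')) enum_uniq.
- by rewrite -size_eq0 size_nbrs; have := degree_gt1 y'; lia.
- move=> a b c abc a_in c_in.
  have [an cn] := (nbrs_ltn a_in, nbrs_ltn c_in).
  have bn : b < n by lia.
  have := convG (y := y') (x1 := Ordinal an) (x2 := Ordinal bn) (x3 := Ordinal cn) abc.
  by rewrite !inE -!mem_nbrs; apply.
Qed.

Lemma adj_interval (x : 'I_n) (y : 'I_(nY G)) :
  adj x y = (lows y <= x < lows y + size (nbrs y)).
Proof. by rewrite -mem_nbrs nbrs_interval ?mem_iota // -nY_nX. Qed.

Lemma nbrs_end y : y < n -> lows y + size (nbrs y) <= n.
Proof.
move=> yn; have s1 := size_nbrs_gt1 yn.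
have : (lows y + size (nbrs y)).-1 \in nbrs y by rewrite nbrs_interval // mem_iota; lia.
by move/nbrs_ltn; lia.
Qed.

Lemma nbrs_hall p q : p.+1 < q -> q <= n -> (0 < p) || (q < n) ->
  count (fun y => (p <= lows y) && (lows y + size (nbrs y) <= q)) (iota 0 n) <= (q - p).-1.
Proof.
move=> pq qn proper; have [hall _ _] := propA.
(* In 1-based bounds [p, q) runs from [p.+1] to [q]. *)
rewrite -subnS; apply: leq_trans (hall p.+1 q _ pq qn _) => //; last by case=> *; lia.
rewrite -[in iota 0 n]nY_nX count_iota_card; apply: subset_leq_card.
apply/subsetP => y; rewrite !inE => /andP[py yq]; apply/subsetP => x.
by rewrite !inE adj_interval; lia.
Qed.

Lemma block_addressS y : block_address y.+1 = block_address y + size (nbrs y) + 1.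
Proof.
by rewrite /block_address -(addn1 y) iotaD map_cat flatten_cat size_cat /= cats0 !addnA addn1 addnS.
Qed.

Lemma encodeE : encode L =
  n :: nY G :: flatten [seq size (nbrs z) :: nbrs z | z <- iota 0 n].
Proof.
rewrite /encode -[X in iota 0 X]nY_nX -val_enum_ord -map_comp.
by congr [:: _, _ & flatten _]; apply: eq_map => y /=; rewrite nbrsE size_map.
Qed.

Lemma nth_encode y j : y < n -> j <= size (nbrs y) ->
  nth 0 (encode L) (block_address y + j) = nth 0 (size (nbrs y) :: nbrs y) j.
Proof.
move=> yn jy; rewrite encodeE /block_address addnAC /=.
have -> : iota 0 n = iota 0 y ++ y :: iota y.+1 (n - y.+1).
  by rewrite -[y :: _]/(iota y (n - y.+1).+1) subnSK // -iotaD subnKC // ltnW.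
rewrite map_cat flatten_cat nth_cat /= addnC ltnNge leq_addr /= addKn.
by rewrite -cat_cons nth_cat /= ltnS jy.
Qed.

Lemma encode_listed y : y < n -> listed nbrs block_address y (nth 0 (encode L)).
Proof.
move=> yn; split=> [|j jy]; first by rewrite -[block_address y]addn0 nth_encode.
by rewrite -addnA nth_encode // add1n.
Qed.

(** After the two header words each y contributes its degree and one more word, and these degrees
    sum to the number of edges. *)
Lemma block_address_gsize : block_address n = gsize G - n + 2.
Proof.
have sumE k : block_address k = 2 + \sum_(z < k) (size (nbrs z)).+1.
  elim: k => [|k IHk]; first by rewrite big_ord0.
  by rewrite block_addressS IHk big_ord_recr /= addn1 -addnS -addnA.
have edges : #|[set e : 'I_n * 'I_(nY G) | adj e.1 e.2]| = \sum_(y < nY G) size (nbrs y).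
  rewrite -sum1_card (eq_bigl (fun e => true && adj e.1 e.2)); last by move=> e; rewrite inE.
  rewrite -(pair_big_dep xpredT (fun x y => adj x y) (fun _ _ => 1)) /= (exchange_big_dep xpredT) //=.
  by apply: eq_bigr => y _; rewrite size_nbrs -sum1_card; apply: eq_bigl => x; rewrite inE.
rewrite sumE /gsize edges -nY_nX.
have -> : \sum_(z < nY G) (size (nbrs z)).+1 = \sum_(z < nY G) size (nbrs z) + nY G.
  rewrite -[X in _ + X]card_ord -sum1_card -big_split /=.
  by apply: eq_bigr => i _; rewrite addn1.
lia.
Qed.

Lemma edge_adjcode (u v : vertex G) :
  adjcode n lows (fun y => lows y + size (nbrs y)) (vcode u) (vcode v) = edge u v.
Proof.
case: u v => [x|y] [x'|y']; rewrite /adjcode /incident /= ?addKn ?adj_interval ?ltn_ord.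
- by have := (ltn_ord x, ltn_ord x') => -[]; lia.
- by rewrite leq_addr (ltnNge (n + y')) leq_addr orbF.
- by rewrite leq_addr (ltnNge (n + y)) leq_addr.
- by rewrite !(ltnNge (n + _)) !leq_addr.
Qed.

Lemma vcode_inj : injective (@vcode G).
Proof.
move=> [x|y] [x'|y'] /= E.
- by congr inl; apply: val_inj.
- by have := ltn_ord x; lia.
- by have := ltn_ord x'; lia.
- by congr inr; apply: val_inj; apply: addnI E.
Qed.

Lemma vcode_surj k : k < n + n -> exists v : vertex G, vcode v = k.
Proof.
move=> kn; have [kx|kx] := ltnP k n; first by exists (inl (Ordinal kx)).
have ky : k - n < nY G by rewrite nY_nX; lia.
by exists (inr (Ordinal ky)); rewrite /= subnKC.
Qed.

Lemma vcode_ltn (v : vertex G) : vcode v < n + n.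
Proof. by case: v => [x|y] /=; [have := ltn_ord x | have := ltn_ord y; have := nY_nX]; lia. Qed.

Lemma hamiltonian_codes (cc : seq nat) :
  cycle (adjcode n lows (fun y => lows y + size (nbrs y))) cc ->
  perm_eq cc (iota 0 (n + n)) ->
  exists c : seq (vertex G), cc = [seq vcode v | v <- c] /\ hamiltonian_cycle c.
Proof.
move=> cyc pe.
have [c cE] : exists c : seq (vertex G), cc = [seq vcode v | v <- c].
  have : {subset cc <= iota 0 (n + n)} by move=> x; rewrite (perm_mem pe).
  elim: cc {cyc pe} => [|k cc IHcc] sub; first by exists [::].
  have [|c ->] := IHcc; first by move=> x xc; apply: sub; rewrite inE xc orbT.
  have := sub k (mem_head _ _); rewrite mem_iota => /vcode_surj[v <-].
  by exists (v :: c).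
exists c; split=> //; split.
- have := perm_size pe; rewrite cE size_map size_iota => ->.
  by have := nX_gt1; lia.
- apply/andP; split; last first.
    by have := perm_uniq pe; rewrite cE iota_uniq => /map_uniq.
  move: cyc; rewrite cE cycle_map; congr is_true; apply: eq_cycle => u v /=.
  exact: edge_adjcode.
- by move=> v; rewrite -(mem_map vcode_inj) -cE (perm_mem pe) mem_iota vcode_ltn.
Qed.

End Input.

(** * The complete program *)

Definition find_cycle : com := records ;; schedule ;; index_slots ;; walk.

Theorem theorem4 :
  exists (P : com) (C : nat),
    forall (G : bigraph) (L : 'I_(nY G) -> seq 'I_(nX G)),
      connected G -> convex G -> propertyA G -> adjacency_lists L ->
      exists (t : nat) (s : state) (c : seq (vertex G)),
        [/\ exec (C * gsize G) P (init_state (encode L)) t s,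
            t <= C * gsize G,
            output s = [seq vcode v | v <- c]
          & hamiltonian_cycle c].
Proof.
(* The phases add up to at most [125 * ad n + 330 * n + 140] steps. With [ad n = gsize G - n + 2],
   [2 * n <= gsize G] and [1 < n] this is within [400 * gsize G], which also bounds all words. *)
exists find_cycle, 400 => G L connG convG propA adjL.
have n1 := nX_gt1 connG propA; have nYn := nY_nX propA.
have sizeE := block_address_gsize propA adjL.
have sizeG : nX G + nX G <= gsize G by apply: leq_trans (leq_addr _ _); rewrite nYn.
set n := nX G in n1 nYn sizeE sizeG *; set W := 400 * gsize G.
pose T := nbrs L; pose ad := block_address L; pose lo := lows L.
pose e y := lo y + size (T y).
have ad0 : ad 0 = 2 by [].
have adS y : y < n -> ad y.+1 = ad y + size (T y) + 1 by move=> _; apply: block_addressS.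
have T_size : forall y, y < n -> 1 < size (T y) by apply: size_nbrs_gt1.
have T_mem : forall y, y < n -> T y =i iota (lo y) (size (T y)) by apply: nbrs_interval.
have e_le : forall y, y < n -> lo y + size (T y) <= n by apply: nbrs_end.
have hall := nbrs_hall convG propA adjL.
have W_large : ad n + 10 * n + 10 <= W by rewrite /W /ad sizeE; lia.
have job_len y : y < n -> lo y + 2 <= e y <= n.
  by move=> yn; have := T_size y yn; have := e_le y yn; rewrite /e; lia.
have init : init_state (encode L) = State (nth 0 (nseq 9 0)) (nth 0 (encode L)).
  by congr State; apply: functional_extensionality => i; rewrite nth_nseq if_same.
have listed0 : partial n T lo ad 0 (nth 0 (encode L)).
  split=> // [y yn|a an]; first by apply: encode_listed => //; case/andP: yn.
  by rewrite nth_default // encodeE.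
have code0 : nth 0 (encode L) 0 = n by [].
suff [t [s [ex [tW [c [outE ham]]]]]] : run W find_cycle 0 (init_state (encode L))
    (fun t s => t <= W /\ exists c : seq (vertex G),
       output s = [seq vcode v | v <- c] /\ hamiltonian_cycle c).
  by exists t, s, c.
rewrite init /find_cycle; apply: run_seq.
apply: run_weaken (run_records adS ad0 T_size T_mem e_le W_large code0 listed0) _.
move=> t _ [m [x5 [x6 [x7 [x8 [-> pm tt]]]]]]; apply: run_seq.
apply: (run_schedule adS ad0 T_size e_le W_large hall) pm _.
move=> t1 sg m1 y3 y5 y6 y7 E S tt1.
pose s := job n sg.
have s_ltn h : h < n -> s h < n := job_ltn job_len hall E (h := h).
have s_inj h k : h < n -> k < n -> s h = s k -> h = k := job_inj job_len hall E (h := h) (k := k).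
have s_slot h : h < n -> [/\ lo (s h) <= h, h < e (s h) & h.+1 < n -> h.+1 < e (s h)].
  exact: (job_slot job_len hall E).
have s_late g : g.+1 < n -> exists h, [/\ h < n, lo (s h) <= g & g < h].
  exact: (late_job job_len hall E).
have ad_small h : h < n -> ad (s h) + 2 < ad n.
  move=> hn; have sn := s_ltn h hn.
  by have := ad_lt adS sn (leqnn n); have := T_size _ sn; lia.
have [rec place _ zero] := S.
have st1 : stored n (ad n) lo s ad m1.
  move=> h hn; have sn := s_ltn h hn; have [_ r1 r2] := rec _ sn; split=> //.
  have sg_h : sg (s h) = h := sg_job job_len hall E hn.
  by rewrite -{1}sg_h place //; lia.
apply: run_seq; apply: (run_index_slots n1 W_large s_slot ad_small) => //.
move=> t2 m2 tt2 st2 lat.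
apply: run_weaken (run_walk n1 W_large s_ltn s_slot s_late ad_small _ _ _ _ _ _ _ st2 lat) _.
move=> t3 st3 [tt3 [fl [Tr [sw outE]]]]; split.
  by rewrite /W; move: tt tt1; rewrite /ad sizeE; lia.
have n0 : 0 < n := ltnW n1.
have [c1 c2 pe] := sweep_cycle s_slot n0 sw.
have [||c [cE ham]] := hamiltonian_codes connG convG propA adjL (cc := rcons (oriented fl Tr) n.-1).
- by case: (fl).
- apply: perm_trans (perm_codes n0 s_ltn s_inj pe).
  by rewrite -!cats1 perm_cat2r /oriented; case: (fl); rewrite ?perm_rev.
by exists c; rewrite outE.
Qed.
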